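(* Let $q$ be a power of two, $A$ a $q$-modular witness in a graph $G$, $d$ a lift modulo $2q$ of the common residue modulo $q$ of the degrees $\deg_A(v)$, and $b_A(v)\in\{0,1\}$ with $\deg_A(v)\equiv d+qb_A(v)\pmod{2q}$. Let $U\subseteq A$, $u_0\in U$, and suppose $D=A\setminus U$ is partitioned into blocks of size $q$, each block consisting of vertices with a common trace on $U$. Assume: (1) for each $u\in U\setminus\{u_0\}$, the number of blocks with trace $\{u\}$ is congruent to $b_A(u)+b_A(u_0)$ modulo $2$; (2) the sum of $[\mathbf 1_{B}]$ over all remaining blocks (those whose trace $B$ is not a singleton $\{u\}$ with $u\ne u_0$; this includes traces $\{u_0\}$, $\varnothing$, $U$ and all non-singleton traces), counted with multiplicity, is zero in $\mathbb F_2^U/\langle\mathbf 1_U\rangle$. Then $U$ is $2q$-modular. In particular, if $|U|\le2q$ then $G[U]$ is regular.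
   Context: Graphs are finite simple; $\deg_S(v)$ is the degree of $v$ in $G[S]$; $S$ is $q$-modular if all $\deg_S(v)$, $v\in S$, are congruent modulo $q$. The trace of $x$ on $U$ is $N(x)\cap U$. $\mathbf 1_B\in\mathbb F_2^U$ is the indicator of $B$; quotient by the constant vector $\mathbf 1_U$. *)

(* Defs.v *)
From HB Require Import structures.
From mathcomp Require Import all_boot all_order all_algebra.
Set Implicit Arguments.
Unset Strict Implicit.
Unset Printing Implicit Defensive.
Import GRing.Theory.

Section GraphDefs.
Variables (T : finType) (e : rel T).
Implicit Types (S U : {set T}) (v x : T).

Definition nbhd x : {set T} := [set y | e x y].

(* degree of v in the induced subgraph G[S], for v \in S *)
Definition deg S v : nat := #|nbhd v :&: S|.

Definition modular (q : nat) S : Prop :=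
  {in S &, forall v w, deg S v = deg S w %[mod q]}.

Definition induced_regular S : Prop :=
  exists k : nat, {in S, forall v, deg S v = k}.

Definition trace U x : {set T} := nbhd x :&: U.

End GraphDefs.

Section QuotientSpace.
Variables (T : finType) (U : {set T}).
Local Open Scope ring_scope.
Local Open Scope quotient_scope.

(* The regular module ('F_2)^o makes this finite function space, F_2^U,
   canonically a vector space over F_2. *)
Notation F2vec := {ffun {u : T | u \in U} -> ('F_2)^o}.

Definition indicator (B : {set T}) : F2vec := [ffun u => (val u \in B)%:R].

(* The additive quotient group F_2^U / <1_U>. *)
Notation F2quot := (Quotient.quot (<[indicator U]>%VS : {vspace F2vec})).

Definition indicator_class (B : {set T}) : F2quot := \pi_F2quot (indicator B).

End QuotientSpace.

(* Main.v *)
(** For [v] in [U], the blocks contribute [q * N v] to [deg A v], where [N v] is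
    the number of blocks whose trace contains [v].  Hypotheses (1) and (2) say
    that [N v] has parity [b v + K] with [K] independent of [v]: at [u0] there is
    no singleton correction, but there [b u0 + b u0] vanishes anyway.  Modulo
    [2 * q] the terms [q * b v] then cancel, leaving
    [deg U v + q * K = d]. *)
Require Import Defs.
From HB Require Import structures.
From mathcomp Require Import all_boot all_order all_algebra.
Set Implicit Arguments.
Unset Strict Implicit.
Unset Printing Implicit Defensive.
Import GRing.Theory.

(** A zero class means that the sum of indicators lies on the line spanned by [indicator U U], so it
    is a constant function on [U]; its value in ['F_2] is the common parity [c]. *)
Lemma indicator_class_sum0 (T : finType) (U : {set T}) (I : finType)
    (Q : pred I) (F : I -> {set T}) :
  (\sum_(i | Q i) indicator_class U (F i) = 0)%R ->
  exists c : bool, {in U, forall v, odd (\sum_(i | Q i) (v \in F i)) = c}.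
Proof.
rewrite /indicator_class -raddf_sum => sum0.
have /vlineP[k sumE] :
    (\sum_(i | Q i) indicator U (F i))%R \in <[indicator U U]>%VS.
  rewrite -[X in X \in _]subr0 Quotient.idealrBE; apply/eqP.
  by rewrite sum0 raddf0.
exists (odd k) => v vU.
have := congr1 (fun f : {ffun {u : T | u \in U} -> _} => f (Sub v vU)) sumE.
rewrite sum_ffunE !ffunE /= vU => /(congr1 val) /=.
under eq_bigr => i _ do rewrite ffunE /=.
rewrite -natr_sum val_Fp_nat // => kE.
(* Scaling in the regular module is multiplication, so the value of [k *: 1] at [v] is [k * 1]. *)
have -> : val k = (\sum_(i | Q i) (v \in F i)) %% 2.
  by rewrite kE -[in LHS](mulr1 k).
by rewrite modn2 oddb.
Qed.

(** By symmetry, [v] is adjacent to [x] in a block [X] exactly when [v] lies in the trace of [x],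
    which is [tr X]. So [v] sees all [q] vertices of a block or none. *)
Lemma deg_partition (T : finType) (e : rel T) (e_sym : symmetric e)
    (q : nat) (A U : {set T}) (U_sub : U \subset A) (P : {set {set T}})
    (tr : {set T} -> {set T}) :
  partition P (A :\: U) ->
  {in P, forall X : {set T}, #|X| = q} ->
  (forall X x, X \in P -> x \in X -> trace e U x = tr X) ->
  {in U, forall v, deg e A v = deg e U v + q * \sum_(X in P) (v \in tr X)}.
Proof.
move=> P_part P_size P_trace v vU; rewrite /deg -(cardsID U).
rewrite -setIA (setIidPr U_sub) -setIDA; congr (_ + _).
have -> : #|nbhd e v :&: (A :\: U)| = \sum_(x in A :\: U) e v x.
  rewrite -sum1_card big_mkcond [RHS]big_mkcond.
  by apply: eq_bigr => x _; rewrite !inE; case: (e v x); rewrite ?if_same.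
rewrite (set_partition_big _ P_part) big_distrr /=.
apply: eq_bigr => X XP; rewrite -(P_size X XP) -sum_nat_const.
apply: eq_bigr => x xX; congr nat_of_bool.
by rewrite -(P_trace X x XP xX) !inE vU andbT e_sym.
Qed.

Lemma modn_mul_odd (q n : nat) : q * n = q * odd n %[mod 2 * q].
Proof.
rewrite -{1}(odd_double_half n) mulnDr -mul2n mulnA (mulnC q 2).
by rewrite [2 * q * _]mulnC addnC modnMDl.
Qed.

(** No vertex is its own neighbour, so degrees inside [U] are below [#|U|], hence below [m], where
    congruence is equality. *)
Lemma modular_small_regular (T : finType) (e : rel T) (e_irr : irreflexive e)
    (m : nat) (U : {set T}) :
  modular e m U -> #|U| <= m -> induced_regular e U.
Proof.
move=> U_mod U_le.
have deg_lt v : v \in U -> deg e U v < m.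
  move=> vU; apply: leq_trans U_le; apply: proper_card.
  apply/properP; split; first exact: subsetIr.
  by exists v; rewrite // !inE e_irr.
have [->|[u uU]] := set_0Vmem U; first by exists 0 => v; rewrite inE.
exists (deg e U u) => v vU.
by rewrite -(modn_small (deg_lt v vU)) (U_mod v u vU uU) modn_small ?deg_lt.
Qed.

Theorem mainTheorem16
  (T : finType) (e : rel T) (e_sym : symmetric e) (e_irr : irreflexive e)
  (q : nat) (q_pow2 : exists k : nat, q = 2 ^ k)
  (A : {set T}) (A_modular : modular e q A)
  (d : nat) (d_lift : forall v, v \in A -> deg e A v = d %[mod q])
  (b : T -> bool)
  (b_def : forall v, v \in A -> deg e A v = d + q * b v %[mod 2 * q])
  (U : {set T}) (U_sub : U \subset A) (u0 : T) (u0_U : u0 \in U)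
  (P : {set {set T}}) (P_part : partition P (A :\: U))
  (P_size : forall X, X \in P -> #|X| = q)
  (tr : {set T} -> {set T})
  (P_trace : forall X x, X \in P -> x \in X -> trace e U x = tr X)
  (singleton_blocks : forall u, u \in U :\ u0 ->
     #|[set X in P | tr X == [set u]]| = b u + b u0 %[mod 2])
  (remaining_blocks :
     (\sum_(X in P | ~~ [exists u in U :\ u0, tr X == [set u]])
        indicator_class U (tr X) = 0)%R) :
  modular e (2 * q) U /\ (#|U| <= 2 * q -> induced_regular e U).
Proof.
have [c remE] := indicator_class_sum0 remaining_blocks.
pose N v := \sum_(X in P) (v \in tr X).
have N_odd : {in U, forall v, odd (N v) = b v (+) (b u0 (+) c)}.
  move=> v vU; rewrite /N.
  rewrite (bigID (fun X => [exists u in U :\ u0, tr X == [set u]])) /=.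
  rewrite oddD remE // addbA; congr (_ (+) _).
  (* Among the traces [[set u]] with [u != u0], only [[set v]] can contain [v], and it occurs here
     only if [v != u0]. *)
  have -> : \sum_(X in P | [exists u in U :\ u0, tr X == [set u]])
               (v \in tr X) = (v != u0) * #|[set X in P | tr X == [set v]]|.
    rewrite -sum1dep_card big_distrr /= [LHS]big_mkcondr [RHS]big_mkcondr /=.
    apply: eq_bigr => X _; case: ifP => [/existsP[u]|/existsPn no_u].
      rewrite !inE => /andP[/andP[u_neq uU] /eqP->].
      rewrite inE (inj_eq set1_inj) [u == v]eq_sym.
      by case: eqP => [->|//]; rewrite u_neq.
    case: ifP => // trX; have := no_u v; rewrite !inE vU trX !andbT.
    by move=> /negbTE->.
  have [->|v_neq] := eqVneq v u0; first by rewrite addbb.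
  rewrite mul1n; have := singleton_blocks v; rewrite !inE v_neq vU !modn2.
  by move=> /(_ isT)/(congr1 odd); rewrite !oddb oddD !oddb.
have degU : {in U, forall v, deg e U v + q * (b u0 (+) c) = d %[mod 2 * q]}.
  move=> v vU; have := b_def v (subsetP U_sub v vU).
  rewrite (deg_partition e_sym U_sub P_part P_size P_trace vU) -/(N v).
  rewrite -modnDmr modn_mul_odd modnDmr N_odd //.
  case: (b v) (b u0 (+) c) => [] []; rewrite /= ?muln0 ?muln1 ?addn0 //.
    (* Both bits are 1: [deg e U v] is congruent to [d + q], and the extra [q] completes a full
       [2 * q]. In the next case, [b v] alone is 1 and [q] cancels on both sides. *)
    by move=> degE; rewrite -modnDml degE modnDml -addnA addnn -mul2n modnDr.
  by move=> /eqP; rewrite eqn_modDr => /eqP.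
have U_mod : modular e (2 * q) U.
  move=> v w vU wU; apply/eqP; rewrite -(eqn_modDr (q * (b u0 (+) c))).
  by rewrite !degU.
by split=> //; apply: modular_small_regular.
Qed.
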